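(* Suppose $\bar V\ge 0$. Consider the platform's problem when all users choose the low level of data sharing: $$\begin{aligned}\max_{I,p_0,p_1}\;& U(k,k)-B(I)F-I-p_0k-S\\ \text{s.t. }& p_0-\alpha\mathcal V\ge p_1-\mathcal V,\quad p_0-\alpha\mathcal V\ge 0,\quad I,p_0,p_1\ge 0,\end{aligned}$$ where $\mathcal V=\bar V+B(I)L$. Then optimal choices of the platform are as follows. 1. If $I_4$ exists, then $(I^*=I_4,\ p_1^*=0,\ p_0^*=\alpha(\bar V+B(I_4)L))$ is optimal. 2. If $I_4$ does not exist, then $(I^*=0,\ p_1^*=0,\ p_0^*=\alpha(\bar V+B(0)L))$ is optimal.
   Context: An online platform with $k\ge 1$ homogeneous users ($k$ an integer) chooses an investment $I\ge 0$ in data protection and data dividends $p_0,p_1\ge 0$ paid to each user for the low and high level of data sharing respectively. $B:[0,\infty)\to\mathbb{R}$ is twice differentiable with $B(I)>0$, $B'(I)<0$, $B''(I)>0$ for all $I$, and $\lim_{I\to\infty}B(I)=0$ ($B(I)$ is the probability of a data breach). $F>0$ is the platform's loss and $L>0$ each user's loss from a data breach; $S\in\mathbb{R}$ is a fixed cost; $U(k,b)\in\mathbb{R}$ is the platform's revenue when $b$ of the $k$ users choose the low level (so $U(k,k)$ is a constant here); $\alpha\in(0,1)$; $\bar V=V-W\in\mathbb{R}$, where $V$ is the value of a user's data and $W$ the value of the platform's free services. A user's expected utility is $p_1-\mathcal V$ at the high level and $p_0-\alpha\mathcal V$ at the low level, with $\mathcal V=\bar V+B(I)L$; the constraints of the problem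 say that the low level is utility-maximizing and gives nonnegative utility. Notation: $I_4=(B')^{-1}\left(\frac{-1}{F+\alpha Lk}\right)$ is the unique $I\ge0$ with $B'(I)=\frac{-1}{F+\alpha Lk}$; ''$I_4$ exists'' means that such a point in $[0,\infty)$ exists. ''Optimal'' means that the stated triple is an optimal solution (maximizer) of the problem. *)

(* Defs.v *)
From Stdlib Require Import Reals.
From Coquelicot Require Import Coquelicot.
Open Scope R_scope.

Definition nonneg_half_line (x : R) : Prop := 0 <= x.

(* Standing assumptions on the breach probability B : [0, oo) -> R, with first
   and second derivatives B' and B''.  Functions on [0, oo) are represented by
   total functions whose values at negative arguments are irrelevant: [D_in] is
   the derivative relative to the half line, hence one-sided at 0. *)
Record breach_probability (B B' B'' : R -> R) : Prop := {
  breach_deriv  : forall I, 0 <= I -> D_in B B' nonneg_half_line I;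
  breach_deriv2 : forall I, 0 <= I -> D_in B' B'' nonneg_half_line I;
  breach_pos    : forall I, 0 <= I -> 0 < B I;
  breach_decr   : forall I, 0 <= I -> B' I < 0;
  breach_convex : forall I, 0 <= I -> 0 < B'' I;
  breach_lim    : is_lim B p_infty 0
}.

Record policy : Type := Policy {
  investment : R;
  div_low    : R;  (* p_0 *)
  div_high   : R   (* p_1 *)
}.

(* The quantity \mathcal V = \bar V + B(I) L. *)
Definition sharing_cost (B : R -> R) (L Vbar I : R) : R := Vbar + B I * L.

Definition utility_high (B : R -> R) (L Vbar : R) (x : policy) : R :=
  div_high x - sharing_cost B L Vbar (investment x).

Definition utility_low (B : R -> R) (L alpha Vbar : R) (x : policy) : R :=
  div_low x - alpha * sharing_cost B L Vbar (investment x).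

Definition all_low_feasible (B : R -> R) (L alpha Vbar : R) (x : policy) : Prop :=
  utility_low B L alpha Vbar x >= utility_high B L Vbar x /\
  utility_low B L alpha Vbar x >= 0 /\
  investment x >= 0 /\ div_low x >= 0 /\ div_high x >= 0.

Definition all_low_profit (k : nat) (U : nat -> nat -> R) (B : R -> R) (F S : R)
    (x : policy) : R :=
  U k k - B (investment x) * F - investment x - div_low x * INR k - S.

Definition is_maximizer {T : Type} (feasible : T -> Prop) (objective : T -> R)
    (x : T) : Prop :=
  feasible x /\ forall y, feasible y -> objective y <= objective x.

Definition all_low_optimal (k : nat) (U : nat -> nat -> R) (B : R -> R)
    (F L S alpha Vbar : R) : policy -> Prop :=
  is_maximizer (all_low_feasible B L alpha Vbar) (all_low_profit k U B F S).

(* [I] is the point I_4 = (B')^{-1}(-1 / (F + alpha L k)) of [0, oo); there is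
   at most one such point, since B'' > 0 makes B' strictly increasing. *)
Definition is_I4 (k : nat) (B' : R -> R) (F L alpha I : R) : Prop :=
  0 <= I /\ B' I = -1 / (F + alpha * L * INR k).

(* Main.v *)
Require Import Defs.
From Stdlib Require Import Reals Lra.
From Coquelicot Require Import Coquelicot.
Open Scope R_scope.

(** At the optimum [p_1 = 0] and [p_0] sits at its lower bound
    [alpha * (Vbar + B I * L)], so the problem is to minimize [c * B I + I] over
    [I >= 0], with [c = F + alpha * L * k].  This function is convex with
    stationary point [I_4].  If [B'] never takes the value [-1/c], it stays above
    it by the intermediate value theorem: by the mean value theorem on
    [[0, c * B 0]], [B' <= -1/c] throughout would force [B (c * B 0) <= 0].  So
    [c * B I + I] is increasing. *)

Lemma Rmax_0_lipschitz (x y : R) : Rabs (Rmax 0 x - Rmax 0 y) <= Rabs (x - y).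
Proof.
unfold Rmax; destruct (Rle_dec 0 x), (Rle_dec 0 y);
  unfold Rabs; repeat destruct Rcase_abs; lra.
Qed.

(* Clamping at 0 turns one-sided regularity on the half line into two-sided
   regularity, as needed by the library versions of MVT and IVT. *)
Lemma continuity_pt_clamp (f f' : R -> R) (x : R) :
  (forall x, 0 <= x -> D_in f f' nonneg_half_line x) ->
  continuity_pt (fun t => f (Rmax 0 t)) x.
Proof.
intros Df.
assert (Hx : 0 <= Rmax 0 x) by apply Rmax_l.
pose proof (cont_deriv _ _ _ _ (Df _ Hx)) as Hc.
intros eps Heps.
destruct (Hc eps Heps) as [d [Hd Hlim]].
exists d; split; [exact Hd|].
intros y [_ Hy]; simpl in *; unfold Rdist in *.
(* The limit in [Hc] ranges over points distinct from the base point, so coinciding clamped points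
   are treated apart. *)
destruct (Req_dec (Rmax 0 x) (Rmax 0 y)) as [E|E].
- rewrite E, Rminus_diag, Rabs_R0; lra.
- apply Hlim; split.
  + split; [apply Rmax_l|exact E].
  + eapply Rle_lt_trans; [apply Rmax_0_lipschitz|exact Hy].
Qed.

(** The clamp has a kink at 0, hence [0 < x]; the mean value theorem needs derivatives only inside
    the interval. *)
Lemma is_derive_clamp (f f' : R -> R) (x : R) :
  (forall x, 0 <= x -> D_in f f' nonneg_half_line x) -> 0 < x ->
  is_derive (fun t => f (Rmax 0 t)) x (f' x).
Proof.
intros Df Hx.
apply is_derive_Reals; intros eps Heps.
destruct (Df x (Rlt_le _ _ Hx) eps Heps) as [d [Hd Hlim]].
(* The bound [x] on the increment keeps [x + h] positive, where the clamp is the identity. *)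
assert (Hm : 0 < Rmin d x) by (apply Rmin_pos; assumption).
exists (mkposreal _ Hm); simpl; intros h Hh Hhd.
assert (Hhx : 0 < x + h).
{ pose proof (Rmin_r d x); apply Rabs_def2 in Hhd; lra. }
rewrite (Rmax_right 0 (x + h)), (Rmax_right 0 x) by lra.
specialize (Hlim (x + h)); simpl in Hlim; unfold Rdist in Hlim.
replace (x + h - x) with h in Hlim by ring.
apply Hlim; split.
- split; [unfold nonneg_half_line; lra|lra].
- pose proof (Rmin_l d x); lra.
Qed.

Lemma half_line_MVT (f f' : R -> R) (a b : R) :
  (forall x, 0 <= x -> D_in f f' nonneg_half_line x) -> 0 <= a -> a < b ->
  exists c, a < c < b /\ f b - f a = f' c * (b - a).
Proof.
intros Df Ha Hab.
assert (pr : forall c, a < c < b -> derivable_pt (fun t => f (Rmax 0 t)) c).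
{ intros c Hc; exists (f' c); apply is_derive_Reals, is_derive_clamp; [exact Df|lra]. }
(* [MVT] is Cauchy's form for two functions; [id] as the second yields Lagrange's. *)
destruct (MVT (fun t => f (Rmax 0 t)) id a b pr (fun c _ => derivable_pt_id c) Hab)
  as [c [Hc E]].
- intros; eapply continuity_pt_clamp; exact Df.
- intros; apply derivable_continuous_pt, derivable_pt_id.
- exists c; split; [exact Hc|].
  rewrite derive_pt_id in E.
  rewrite (derive_pt_eq_0 _ _ (f' c)) in E
    by (apply is_derive_Reals, is_derive_clamp; [exact Df|lra]).
  unfold id in E; rewrite (Rmax_right 0 a), (Rmax_right 0 b) in E by lra; lra.
Qed.

Lemma half_line_IVT (f f' : R -> R) (a b y : R) :
  (forall x, 0 <= x -> D_in f f' nonneg_half_line x) ->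
  f (Rmax 0 a) <= y <= f (Rmax 0 b) -> exists x, 0 <= x /\ f x = y.
Proof.
intros Df Hy.
destruct (IVT_gen (fun t => f (Rmax 0 t)) a b y) as [x [_ Hx]].
- intros t; eapply continuity_pt_clamp; exact Df.
- split; [eapply Rle_trans; [apply Rmin_l|]|eapply Rle_trans; [|apply Rmax_r]]; lra.
- exists (Rmax 0 x); split; [apply Rmax_l|exact Hx].
Qed.

(** Mean value theorem between [x] and [x0]. For [x0 = 0] the condition on the left is vacuous,
    which serves the boundary case. *)
Lemma half_line_min (f f' : R -> R) (x0 x : R) :
  (forall x, 0 <= x -> D_in f f' nonneg_half_line x) -> 0 <= x0 ->
  (forall x, 0 <= x < x0 -> f' x <= 0) ->
  (forall x, x0 < x -> 0 <= f' x) ->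
  0 <= x -> f x0 <= f x.
Proof.
intros Df H0 Hl Hr Hx.
destruct (Rtotal_order x x0) as [H|[->|H]]; [|lra|].
- destruct (half_line_MVT f f' x x0 Df Hx H) as [c [Hc E]].
  assert (f' c <= 0) by (apply Hl; lra); nra.
- destruct (half_line_MVT f f' x0 x Df H0 H) as [c [Hc E]].
  assert (0 <= f' c) by (apply Hr; lra); nra.
Qed.

Section TotalCost.

Variables (B B' B'' : R -> R) (c : R).
Hypotheses (hB : breach_probability B B' B'') (hc : 0 < c).

Lemma D_in_total_cost (x : R) : 0 <= x ->
  D_in (fun I => c * B I + I) (fun I => c * B' I + 1) nonneg_half_line x.
Proof.
intros Hx; apply Dadd; [apply Dmult_const, (breach_deriv _ _ _ hB), Hx|apply Dx].
Qed.

Lemma breach_deriv_increasing (x y : R) : 0 <= x -> x < y -> B' x < B' y.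
Proof.
intros Hx Hxy.
destruct (half_line_MVT B' B'' x y (breach_deriv2 _ _ _ hB) Hx Hxy) as [z [Hz E]].
assert (0 < B'' z) by (apply (breach_convex _ _ _ hB); lra); nra.
Qed.

Lemma total_cost_min_stationary (I4 I : R) :
  0 <= I4 -> B' I4 = -1 / c -> 0 <= I -> c * B I4 + I4 <= c * B I + I.
Proof.
intros H4 E HI.
assert (E' : c * B' I4 = -1) by (rewrite E; field; lra).
apply (half_line_min _ _ I4 I D_in_total_cost); try assumption; intros x Hx.
- assert (B' x < B' I4) by (apply breach_deriv_increasing; lra); nra.
- assert (B' I4 < B' x) by (apply breach_deriv_increasing; lra); nra.
Qed.

Lemma breach_deriv_exceeds : exists x, 0 <= x /\ -1 / c <= B' x.
Proof.
assert (H0 : 0 < B 0) by (apply (breach_pos _ _ _ hB); lra).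
assert (Hm : 0 < c * B 0) by nra.
destruct (half_line_MVT B B' 0 (c * B 0) (breach_deriv _ _ _ hB) (Rle_refl 0) Hm)
  as [x [Hx E]].
exists x; split; [lra|].
assert (0 < B (c * B 0)) by (apply (breach_pos _ _ _ hB); lra).
apply Rle_div_l; [lra|].
(* Positivity of [B (c * B 0)] turns [E] into [- B 0 < B' x * (c * B 0)]; divide by [B 0]. *)
nra.
Qed.

Lemma total_cost_min_boundary (I : R) :
  (~ exists I4, 0 <= I4 /\ B' I4 = -1 / c) -> 0 <= I -> c * B 0 + 0 <= c * B I + I.
Proof.
intros Hno HI.
apply (half_line_min _ _ 0 I D_in_total_cost); try lra; intros x Hx; [lra|].
destruct (Rle_lt_dec (B' x) (-1 / c)) as [Hle|Hlt].
- exfalso; apply Hno.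
  destruct breach_deriv_exceeds as [y [Hy Hge]].
  apply (half_line_IVT B' B'' x y); [apply (breach_deriv2 _ _ _ hB)|].
  rewrite !Rmax_right by lra; lra.
- apply Rlt_div_l in Hlt; lra.
Qed.

End TotalCost.

(** Since [p0 >= alpha * (Vbar + B I * L)], profit is at most a constant minus the cost minimized in
    the last hypothesis, with equality at the stated policy. [0 <= Vbar] makes the sharing cost
    nonnegative, so [p0] is nonnegative and [p1 = 0] does not tempt users to the high level. *)
Lemma all_low_optimal_of_min_cost (k : nat) (U : nat -> nat -> R) (B : R -> R)
    (F L S alpha Vbar I0 : R) :
  (forall I, 0 <= I -> 0 <= B I) -> 0 <= L -> 0 <= alpha <= 1 -> 0 <= Vbar ->
  0 <= I0 ->
  (forall I, 0 <= I ->
     (F + alpha * L * INR k) * B I0 + I0 <= (F + alpha * L * INR k) * B I + I) ->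
  all_low_optimal k U B F L S alpha Vbar
    {| investment := I0; div_low := alpha * (Vbar + B I0 * L); div_high := 0 |}.
Proof.
intros HB HL Ha HV H0 Hmin.
assert (Hcost : 0 <= Vbar + B I0 * L) by (specialize (HB I0 H0); nra).
split.
- unfold all_low_feasible, utility_low, utility_high, sharing_cost; simpl.
  repeat split; nra.
- intros [I p0 p1]; unfold all_low_feasible, all_low_profit, utility_low,
    utility_high, sharing_cost; simpl.
  intros (_ & Hp0 & HI & _ & _).
  specialize (Hmin I (Rge_le _ _ HI)).
  assert (alpha * (Vbar + B I * L) * INR k <= p0 * INR k)
    by (apply Rmult_le_compat_r; [apply pos_INR|lra]).
  nra.
Qed.

Theorem mainTheorem8
  (k : nat) (U : nat -> nat -> R) (B B' B'' : R -> R)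
  (F L S alpha V W : R)
  (hk : (1 <= k)%nat)
  (hB : breach_probability B B' B'')
  (hF : 0 < F) (hL : 0 < L)
  (halpha : 0 < alpha < 1)
  (hVbar : 0 <= V - W) :
  (forall I4 : R, is_I4 k B' F L alpha I4 ->
     all_low_optimal k U B F L S alpha (V - W)
       {| investment := I4;
          div_low := alpha * ((V - W) + B I4 * L);
          div_high := 0 |})
  /\
  ((~ exists I4 : R, is_I4 k B' F L alpha I4) ->
     all_low_optimal k U B F L S alpha (V - W)
       {| investment := 0;
          div_low := alpha * ((V - W) + B 0 * L);
          div_high := 0 |}).
Proof.
assert (Hc : 0 < F + alpha * L * INR k).
{ pose proof (pos_INR k); assert (0 < alpha * L) by nra; nra. }
assert (HB : forall I, 0 <= I -> 0 <= B I)
  by (intros I HI; apply Rlt_le, (breach_pos _ _ _ hB), HI).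
split.
- intros I4 [H4 E]; apply all_low_optimal_of_min_cost; try assumption; try lra.
  intros I HI; eapply total_cost_min_stationary; eassumption.
- intros Hno; apply all_low_optimal_of_min_cost; try assumption; try lra.
  intros I HI; eapply total_cost_min_boundary; eassumption.
Qed.
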